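(* Let $g : [a,b] \to \mathbb{R}$ be continuous and let $G : [a,b] \to \mathbb{R}$ be a continuous function satisfying \[ G(x) - G(a) = \int_a^x g(t)\,dt \quad \text{for every } x \in [a,b]. \] Let $f$ be a continuous real-valued function on a closed interval containing $G([a,b])$. Then \[ \int_a^b f(G(t))\,g(t)\,dt = \int_{G(a)}^{G(b)} f(u)\,du. \]
   Context: Integrals are Riemann integrals, with the convention $\int_\beta^\alpha = -\int_\alpha^\beta$ when $\beta > \alpha$ and $\int_\alpha^\alpha = 0$. *)

(* Defs.v *)
From Stdlib Require Import Reals.
From Coquelicot Require Import Coquelicot.
Open Scope R_scope.

Definition Icc (a b : R) : R -> Prop := fun x => a <= x <= b.

(* Main.v *)
Require Import Defs.
From Stdlib Require Import Reals Lra.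
From Coquelicot Require Import Coquelicot.
Open Scope R_scope.

(** The functions [f] and [g] are only continuous relative to closed intervals, so
    both are extended continuously to the whole line, constantly outside their
    intervals. The primitive of the extended [g] is then a [C^1] function agreeing
    with [G] on [[a, b]], and the substitution rule for [C^1] functions applies. *)

Definition clamp (a b x : R) : R := Rmax a (Rmin x b).

Lemma clamp_Icc (a b x : R) : a <= b -> Icc a b (clamp a b x).
Proof.
  intros hab; unfold Icc, clamp.
  split; [apply Rmax_l | apply Rmax_lub; [exact hab | apply Rmin_r]].
Qed.

Lemma clamp_id (a b x : R) : Icc a b x -> clamp a b x = x.
Proof.
  intros [hax hxb]; unfold clamp.
  now rewrite Rmin_left, Rmax_right.
Qed.

Lemma clamp_nonexpansive (a b x y : R) :
  Rabs (clamp a b y - clamp a b x) <= Rabs (y - x).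
Proof.
  unfold clamp, Rmax, Rmin, Rabs.
  repeat destruct Rle_dec; repeat destruct Rcase_abs; lra.
Qed.

(** Since [clamp] does not increase distances, it sends the [eps]-ball around [x] into the part of
    [[a, b]] within [eps] of [clamp a b x]. Continuity relative to [[a, b]] is therefore enough,
    even at the endpoints. *)
Lemma continuous_clamp_ext {U : UniformSpace} (a b : R) (f : R -> U) (x : R) :
  a <= b -> continuous_on (Icc a b) f ->
  continuous (fun y => f (clamp a b y)) x.
Proof.
  intros hab hf.
  apply filterlim_comp with (within (Icc a b) (locally (clamp a b x))).
  - intros P [eps hP]; exists eps; intros y hy.
    apply hP; [| now apply clamp_Icc].
    eapply Rle_lt_trans; [apply clamp_nonexpansive | exact hy].
  - apply hf; now apply clamp_Icc.
Qed.

(** Continuity everywhere makes [f] integrable up to every [y], so [RInt f a y] is a genuine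
    integral near [x] and not a default value. *)
Lemma is_derive_RInt_continuous {V : CompleteNormedModule R_AbsRing}
  (f : R -> V) (a x : R) :
  (forall y, continuous f y) -> is_derive (fun y => RInt f a y) x (f x).
Proof.
  intros hf; apply is_derive_RInt with a; [| apply hf].
  apply filter_forall; intros y.
  apply @RInt_correct, ex_RInt_continuous; intros z _; apply hf.
Qed.

Theorem theorem4p1 (a b : R) (hab : a <= b) (g G : R -> R)
  (hg : continuous_on (Icc a b) g)
  (hGcont : continuous_on (Icc a b) G)
  (hG : forall x : R, Icc a b x -> G x - G a = RInt g a x)
  (c d : R) (f : R -> R)
  (hGcd : forall x : R, Icc a b x -> Icc c d (G x))
  (hf : continuous_on (Icc c d) f) :
  ex_RInt (fun t : R => f (G t) * g t) a b /\
  ex_RInt f (G a) (G b) /\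
  RInt (fun t : R => f (G t) * g t) a b = RInt f (G a) (G b).
Proof.
  assert (ha : Icc a b a) by (unfold Icc; lra).
  assert (hb : Icc a b b) by (unfold Icc; lra).
  assert (hGa := hGcd a ha); assert (hGb := hGcd b hb).
  assert (hcd : c <= d) by (unfold Icc in hGa; lra).
  set (f' := fun u => f (clamp c d u)).
  set (g' := fun t => g (clamp a b t)).
  set (H := fun x => G a + RInt g' a x).
  assert (cf : forall u, continuous f' u)
    by (intros u; now apply continuous_clamp_ext).
  assert (cg : forall t, continuous g' t)
    by (intros t; now apply continuous_clamp_ext).
  assert (ef : forall u, Icc c d u -> f' u = f u)
    by (intros u hu; unfold f'; now rewrite clamp_id).
  assert (eg : forall t, Icc a b t -> g' t = g t)
    by (intros t ht; unfold g'; now rewrite clamp_id).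
  assert (eH : forall x, Icc a b x -> H x = G x).
  { intros x hx; unfold H.
    replace (G x) with (G a + RInt g a x) by (rewrite <- (hG x hx); ring).
    f_equal; apply RInt_ext; intros t ht.
    apply eg; unfold Icc in *.
    rewrite Rmin_left, Rmax_right in ht; lra. }
  assert (dH : forall x, is_derive H x (g' x)).
  (* The zero summand is the derivative of the constant [G a]. *)
  { intros x; unfold H.
    replace (g' x) with (plus zero (g' x)) by apply plus_zero_l.
    apply @is_derive_plus; [apply @is_derive_const |].
    now apply @is_derive_RInt_continuous. }
  (* [G a] and [G b] may come in either order; all points between them lie in [[c, d]] by
     convexity. *)
  assert (ef_range : forall u, Rmin (G a) (G b) < u < Rmax (G a) (G b) -> f' u = f u).
  { intros u hu; apply ef; unfold Icc in *; revert hu.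
    unfold Rmin, Rmax; destruct Rle_dec; lra. }
  (* This one relation carries both the integrability of the left-hand integrand and the value of
     its integral. *)
  assert (I : is_RInt (fun t => f (G t) * g t) a b (RInt f (G a) (G b))).
  (* The target becomes the integral of [f'] from [H a] to [H b], the form that the substitution
     rule produces. *)
  { rewrite <- (RInt_ext _ _ _ _ ef_range), <- (eH a ha), <- (eH b hb).
    apply is_RInt_ext with (fun t => scal (g' t) (f' (H t))).
    - intros t ht; rewrite Rmin_left, Rmax_right in ht by assumption.
      assert (ht' : Icc a b t) by (unfold Icc; lra).
      rewrite (eH t ht'), (eg t ht'), (ef _ (hGcd t ht')); apply Rmult_comm.
    - apply (is_RInt_comp f' H g'); auto. }
  split; [now exists (RInt f (G a) (G b)) | split].
  - apply ex_RInt_ext with f'; [exact ef_range |].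
    apply @ex_RInt_continuous; auto.
  - now apply is_RInt_unique.
Qed.
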